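(* Let $\bm{A}_{1},\ldots,\bm{A}_{m}$ be $n\times n$ matrices over $\mathbb{R}_{\max,\times}$ (that is, with nonnegative real entries) such that the matrix $\bm{B}=\bm{A}_{1}\oplus\bm{A}_{1}^{-}\oplus\cdots\oplus\bm{A}_{m}\oplus\bm{A}_{m}^{-}$ has no zero entries. Let $\mu$ be the spectral radius of $\bm{B}$, and let $\bm{B}_{\mu}=\mu^{-1}\bm{B}$. Consider the problem of minimizing $\max_{1\leq i\leq m}\rho(\bm{A}_{i},\bm{x}\bm{x}^{-})$ over all regular column vectors $\bm{x}$ with $n$ entries (that is, over all $\bm{x}\in\mathbb{R}_{+}^{n}$). Then the minimum value in this problem is equal to $\mu$, and all solutions (the regular vectors attaining the minimum) are given by $$\bm{x}=\bm{B}_{\mu}^{\ast}\bm{u},\qquad \bm{u}\in\mathbb{R}_{+}^{n}.$$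
   Context: Semifield: $\mathbb{R}_{+}=\{x\in\mathbb{R}\mid x>0\}$, and $\mathbb{R}_{\max,\times}=(\mathbb{R}_{+}\cup\{0\},\max,\times,0,1)$ is the idempotent semifield of nonnegative reals in which addition is $x\oplus y=\max(x,y)$, multiplication is the usual multiplication, the zero is $0$ and the unit is $1$; inverses, powers (including rational exponents) and the order are the usual ones. Vectors and matrices: all vector and matrix sums and products are computed with $\oplus=\max$ in place of $+$ and with the usual multiplication; e.g. $(\bm{A}\oplus\bm{B})_{ij}=\max(a_{ij},b_{ij})$, $(\bm{A}\bm{B})_{ij}=\max_k a_{ik}b_{kj}$. A vector is regular if it has no zero entries. For a column vector $\bm{x}=(x_i)$, $\bm{x}^{-}$ is the row vector with entries $x_i^{-1}$ if $x_i\neq 0$ and $0$ otherwise; so for regular $\bm{x}$, $\bm{x}\bm{x}^{-}$ is the $n\times n$ matrix with entries $x_i/x_j$. For a matrix $\bm{A}=(a_{ij})$, $\bm{A}^{-}$ is the matrix whose $(i,j)$ entry is $a_{ji}^{-1}$ if $a_{ji}\neq 0$ and $0$ otherwise. $\bm{I}$ is the identity matrix ($1$ on the diagonal and $0$ elsewhere), $\bm{A}^{0}=\bm{I}$, $\bm{A}^{p}=\bm{A}^{p-1}\bm{A}$. The trace is $\mathrm{tr}\,\bm{A}=a_{11}\oplus\cdots\oplus a_{nn}=\max_i a_{ii}$. Approximation error (Chebyshev-like distance): $\rho(\bm{A},\bm{B})=\mathrm{tr}(\bm{B}^{-}\bm{A})\oplus\mathrm{tr}(\bm{A}^{-}\bm{B})$.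 Spectral radius: the spectral radius of an $n\times n$ matrix $\bm{A}=(a_{ij})$ is its maximum eigenvalue in the max-times sense (a scalar $\lambda$ with $\bm{A}\bm{x}=\lambda\bm{x}$ for some nonzero vector $\bm{x}$), calculated as $\lambda=\bigoplus_{k=1}^{n}\mathrm{tr}^{1/k}(\bm{A}^{k})=\max_{1\le k\le n}\ \max_{1\le i_1,\ldots,i_k\le n}(a_{i_1i_2}a_{i_2i_3}\cdots a_{i_ki_1})^{1/k}$. Kleene star: for an $n\times n$ matrix $\bm{A}$ with $\mathrm{tr}\,\bm{A}\oplus\cdots\oplus\mathrm{tr}\,\bm{A}^{n}\le 1$, $\bm{A}^{\ast}=\bm{I}\oplus\bm{A}\oplus\cdots\oplus\bm{A}^{n-1}$. *)

(* Defs.v *)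
From HB Require Import structures.
From mathcomp Require Import all_boot all_order all_algebra.
From mathcomp Require Import boolp classical_sets reals interval_inference.

Set Implicit Arguments.
Unset Strict Implicit.
Unset Printing Implicit Defensive.

Import Order.TTheory GRing.Theory Num.Theory.

Local Open Scope ring_scope.
Local Open Scope classical_set_scope.

(* The max-times semifield: nonnegative reals with [+] := max, [*] the usual
   product, and the usual order.  It is an alias of {nonneg R} so that it can
   carry this semiring structure; through it, the library's sums, matrix
   products, powers, scalings and traces over [maxtimes R] are the max-times
   ones.  The underlying real of [x] is [x%:num]. *)
Definition maxtimes (R : realType) : Type := {nonneg R}.

Section MaxTimes.
Variable R : realType.

HB.instance Definition _ := Order.Total.on (maxtimes R).

Definition mt_zero : maxtimes R := 0%:nng.
Definition mt_one : maxtimes R := 1%:nng.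
Definition mt_add (x y : maxtimes R) : maxtimes R :=
  (Num.max x%:num y%:num)%:nng.
Definition mt_mul (x y : maxtimes R) : maxtimes R := (x%:num * y%:num)%:nng.

(* As in any MathComp field the inverse of 0 in [R] is 0, so [mt_inv 0] = 0:
   this is the convention wanted for conjugate transposes. *)
Definition mt_inv (x : maxtimes R) : maxtimes R := (x%:num^-1)%:nng.

Fact mt_addA : associative mt_add.
Proof. by move=> x y z; apply/val_inj; rewrite /= maxA. Qed.
Fact mt_addC : commutative mt_add.
Proof. by move=> x y; apply/val_inj; rewrite /= maxC. Qed.
Fact mt_add0 : left_id mt_zero mt_add.
Proof. by move=> x; apply/val_inj/max_idPr => /=. Qed.
Fact mt_mulA : associative mt_mul.
Proof. by move=> x y z; apply/val_inj; rewrite /= mulrA. Qed.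
Fact mt_mulC : commutative mt_mul.
Proof. by move=> x y; apply/val_inj; rewrite /= mulrC. Qed.
Fact mt_mul1 : left_id mt_one mt_mul.
Proof. by move=> x; apply/val_inj; rewrite /= mul1r. Qed.
Fact mt_mulDl : left_distributive mt_mul mt_add.
Proof. by move=> x y z; apply/val_inj; rewrite /= maxr_pMl. Qed.
Fact mt_mul0 : left_zero mt_zero mt_mul.
Proof. by move=> x; apply/val_inj; rewrite /= mul0r. Qed.
Fact mt_one_neq0 : mt_one != mt_zero.
Proof. by rewrite -(inj_eq val_inj) /= oner_eq0. Qed.

HB.instance Definition _ := GRing.isNmodule.Build (maxtimes R)
  mt_addA mt_addC mt_add0.
HB.instance Definition _ := GRing.Nmodule_isComPzSemiRing.Build (maxtimes R)
  mt_mulA mt_mulC mt_mul1 mt_mulDl mt_mul0.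
HB.instance Definition _ := GRing.PzSemiRing_isNonZero.Build (maxtimes R)
  mt_one_neq0.

End MaxTimes.

(* No zero entries; for a column vector this means membership in R_+^n. *)
Definition regular (R : realType) m n (A : 'M[maxtimes R]_(m, n)) : Prop :=
  forall i j, A i j != 0.

Definition conj_tr (R : realType) m n (A : 'M[maxtimes R]_(m, n)) :
  'M[maxtimes R]_(n, m) := \matrix_(i, j) mt_inv (A j i).

Definition rho (R : realType) n (A B : 'M[maxtimes R]_n) : maxtimes R :=
  \tr (conj_tr B *m A) + \tr (conj_tr A *m B).

Definition mt_eigenvalue (R : realType) n (A : 'M[maxtimes R]_n)
    (l : maxtimes R) : Prop :=
  exists2 x : 'cV[maxtimes R]_n, x != 0 & A *m x = l *: x.

Definition max_eigenvalue (R : realType) n (A : 'M[maxtimes R]_n)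
    (l : maxtimes R) : Prop :=
  mt_eigenvalue A l /\ forall l', mt_eigenvalue A l' -> l' <= l.

(* The maximum eigenvalue; the default value 0 is used only if there is none. *)
Definition spectral_radius (R : realType) n (A : 'M[maxtimes R]_n) :
  maxtimes R := xget 0 [set l | max_eigenvalue A l].

Definition kleene_star (R : realType) n (A : 'M[maxtimes R]_n) :
  'M[maxtimes R]_n := \sum_(0 <= k < n) A ^+ k.

Definition minimum_value (R : realType) (T : Type) (D : set T)
    (f : T -> maxtimes R) (v : maxtimes R) : Prop :=
  (exists2 x, D x & f x = v) /\ forall x, D x -> v <= f x.

Definition minimizer (R : realType) (T : Type) (D : set T)
    (f : T -> maxtimes R) (x : T) : Prop :=
  D x /\ forall y, D y -> f x <= f y.

(* Main.v *)
(* For regular x the objective equals x^- B x, so it is at most t exactly when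
   B x <= t x.  If B v = mu v with v regular, comparing v with the smallest
   multiple of x above it shows that B x <= t x forces mu <= t; hence mu is the
   minimum, attained at v, and the solutions are the regular x with
   B_mu x <= x.  As the cycles of B_mu have weight at most 1, cutting cycles out
   of walks shows that B_mu^* dominates every power of B_mu, which identifies
   these x with the vectors B_mu^* u.  The eigenvector v itself is a column of
   the Kleene star of B divided by its maximal cycle mean. *)

Require Import Defs.
From mathcomp Require Import all_boot all_order all_algebra.
From mathcomp Require Import boolp classical_sets reals interval_inference.
From mathcomp Require Import exp zify.

Set Implicit Arguments.
Unset Strict Implicit.
Unset Printing Implicit Defensive.

Import Order.TTheory GRing.Theory Num.Theory.

Local Open Scope ring_scope.
Local Open Scope classical_set_scope.

Lemma not_uniq_split (T : eqType) (s : seq T) : ~~ uniq s ->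
  exists y s1 s2 s3, s = s1 ++ y :: s2 ++ y :: s3.
Proof.
elim: s => // y s IH; rewrite cons_uniq negb_and negbK => /orP[|/IH].
- by case/splitPr => s2 s3; exists y, [::], s2, s3.
- by case=> z [s1 [s2 [s3 ->]]]; exists z, (y :: s1), s2, s3.
Qed.

(** * Order, sums and roots in the max-times semifield *)

Section MaxTimesOrder.
Context {R : realType}.
Implicit Types (x y z t : maxtimes R) (k : nat).

Lemma mt_leE x y : (x <= y) = (x%:num <= y%:num).
Proof. by []. Qed.

Lemma mt_ge0 x : (0 : maxtimes R) <= x.
Proof. exact: (ge0 (x : {nonneg R})). Qed.

Lemma mt_addE x y : x + y = Order.max x y.
Proof.
case: (leP x y) => [|/ltW] h; apply/val_inj => /=.
- by apply/max_idPr.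
- by apply/max_idPl.
Qed.

Lemma mt_add_le x y z : (x + y <= z) = (x <= z) && (y <= z).
Proof. by rewrite mt_addE ge_max. Qed.

Lemma mt_sum_le (I : Type) (r : seq I) (P : pred I) (F : I -> maxtimes R) t :
  (forall i, P i -> F i <= t) -> \sum_(i <- r | P i) F i <= t.
Proof.
move=> h; elim/big_ind: _ => // [|x y xt yt]; first exact: mt_ge0.
by rewrite mt_add_le xt.
Qed.

Lemma mt_le_sum (I : eqType) (r : seq I) (F : I -> maxtimes R) i :
  i \in r -> F i <= \sum_(j <- r) F j.
Proof.
elim: r => // j r IH; rewrite inE big_cons mt_addE le_max.
case/orP=> [/eqP ->|/IH ->].
- by rewrite lexx.
- by rewrite orbT.
Qed.

Lemma mt_sum_attained (I : finType) (F : I -> maxtimes R) :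
  (0 < #|I|)%N -> exists i, \sum_j F j = F i.
Proof.
move=> /card_gt0P[i0 _].
have [i _ Fi] := arg_maxP F (isT : predT i0).
exists i; apply/le_anti; rewrite mt_le_sum ?mem_index_enum // andbT.
by apply: mt_sum_le => j _; apply: Fi.
Qed.

Lemma mt_mul_le x y z t : x <= y -> z <= t -> x * z <= y * t.
Proof. by move=> xy zt; apply: ler_pM. Qed.

Lemma mt_neq0 x : (x != 0) = (0 < x%:num).
Proof. by rewrite lt_def -(inj_eq val_inj) /= ge0 andbT. Qed.

Lemma mt_mul_neq0 x y : (x * y != 0) = (x != 0) && (y != 0).
Proof. by rewrite -!(inj_eq val_inj) /= mulf_eq0 negb_or. Qed.

Lemma mt_le_mul2r z x y : z != 0 -> (x * z <= y * z) = (x <= y).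
Proof. by rewrite mt_neq0 => z0; rewrite !mt_leE /= ler_pM2r. Qed.

Lemma mt_mulVx x : x != 0 -> mt_inv x * x = 1.
Proof. by rewrite mt_neq0 => x0; apply/val_inj; rewrite /= mulVf ?gt_eqF. Qed.

Lemma mt_invM x y : mt_inv (x * y) = mt_inv x * mt_inv y.
Proof. by apply/val_inj; rewrite /= invfM. Qed.

Lemma mt_invK : involutive (@mt_inv R).
Proof. by move=> x; apply/val_inj; rewrite /= invrK. Qed.

Lemma mt_num_exp x k : (x ^+ k)%:num = x%:num ^+ k.
Proof. by elim: k => // k IH; rewrite !exprS /= IH. Qed.

Lemma mt_exp_le k x y : x <= y -> x ^+ k <= y ^+ k.
Proof. by move=> xy; elim: k => // k IH; rewrite !exprS mt_mul_le. Qed.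

Definition mt_root k x : maxtimes R := NngNum (powR_ge0 x%:num k%:R^-1).

Lemma mt_rootK k x : mt_root k.+1 x ^+ k.+1 = x.
Proof.
apply/val_inj; rewrite /= mt_num_exp /= -powR_mulrn ?powR_ge0 //.
by rewrite -powRrM mulVf ?pnatr_eq0 // powRr1.
Qed.

End MaxTimesOrder.

(** * Walks, their weights, and the Kleene star *)

Section Walks.
Context {R : realType} {n : nat}.
Implicit Types (A : 'M[maxtimes R]_n) (i j : 'I_n) (s : seq 'I_n).

(** A walk is its start [i] with the list [s] of later nodes: it has [size s] edges, ends at
    [last i s], and is closed when [last i s = i]. *)
Fixpoint walk_weight A i s : maxtimes R :=
  if s is j :: s' then A i j * walk_weight A j s' else 1.

Lemma walk_weight_cat A i s1 s2 :
  walk_weight A i (s1 ++ s2) =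
  walk_weight A i s1 * walk_weight A (last i s1) s2.
Proof. by elim: s1 i => [|j s1 IH] i /=; rewrite ?mul1r // IH mulrA. Qed.

Lemma walk_weight_scale c A i s :
  walk_weight (c *: A) i s = c ^+ size s * walk_weight A i s.
Proof.
elim: s i => [|j s IH] i /=; first by rewrite mul1r.
by rewrite IH mxE exprS mulrACA.
Qed.

Lemma mulmx_entry_le m p (A : 'M[maxtimes R]_(m, n)) (B : 'M_(n, p))
    (i : 'I_m) (j : 'I_p) k :
  A i k * B k j <= (A *m B) i j.
Proof.
by rewrite mxE (mt_le_sum (fun k => A i k * B k j)) ?mem_index_enum.
Qed.

Lemma walk_weight_le_expmx A i s :
  walk_weight A i s <= (A ^+ size s) i (last i s).
Proof.
elim: s i => [|j s IH] i /=; first by rewrite mxE eqxx.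
rewrite exprS; apply: le_trans (mulmx_entry_le _ _ _ _ j).
exact: mt_mul_le.
Qed.

(* A zero entry gives no control over where the walk ends. *)
Lemma expmx_walk A k i j :
  exists s, (A ^+ k) i j <= walk_weight A i s /\
    ((A ^+ k) i j != 0 -> last i s = j).
Proof.
elim: k i => [|k IH] i.
  exists [::]; rewrite expr0 mxE /=; split.
    by case: eqP => // _; apply: mt_ge0.
  by case: (i =P j) => // _ /eqP.
rewrite exprS mxE.
have [|l ->] := mt_sum_attained (fun l => A i l * (A ^+ k) l j).
  by apply/card_gt0P; exists i.
have [s [h1 h2]] := IH l; exists (l :: s); split=> /=; first exact: mt_mul_le.
by rewrite mt_mul_neq0 => /andP[_ /h2].
Qed.

Definition cycles_le1 A := forall i s, last i s = i -> walk_weight A i s <= 1.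

(** Shorten the tail first. If the start then recurs in it, drop everything up to that recurrence:
    the dropped part is a cycle of weight at most 1, so the weight does not decrease. *)
Lemma walk_shorten A i s : cycles_le1 A ->
  exists s', [/\ last i s' = last i s, uniq (i :: s') &
    walk_weight A i s <= walk_weight A i s'].
Proof.
move=> A1; elim: s i => [|j s IH] i; first by exists [::].
have [s' [ls us ws]] := IH j; rewrite /= -ls.
have {ws} : A i j * walk_weight A j s <= walk_weight A i (j :: s').
  exact: mt_mul_le.
rewrite -[last j s']/(last i (j :: s')).
move: (j :: s') us => t ut wt; have [it|it] := boolP (i \in t); last first.
  by exists t; split=> //=; rewrite it.
case/path.splitP: it ut wt => t1 t2 ut wt; exists t2; split.
- by rewrite last_cat last_rcons.
- move: ut; rewrite cat_uniq => /and3P[_ /hasPn ut ut2]; rewrite /= ut2 andbT.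
  by apply/negP => /ut; rewrite /= mem_rcons mem_head.
- apply: le_trans wt _; rewrite walk_weight_cat last_rcons -[leRHS]mul1r.
  by apply: mt_mul_le => //; apply: A1; rewrite last_rcons.
Qed.

Lemma kleene_star_le A i j t :
  (forall s, last i s = j -> walk_weight A i s <= t) ->
  kleene_star A i j <= t.
Proof.
move=> h; rewrite /kleene_star summxE; apply: mt_sum_le => k _.
have [s [ws ls]] := expmx_walk A k i j.
have [->|/ls/h] := eqVneq ((A ^+ k) i j) 0; first exact: mt_ge0.
exact: le_trans.
Qed.

Lemma expmx_le_kleene_star A k i j :
  (k < n)%N -> (A ^+ k) i j <= kleene_star A i j.
Proof.
move=> kn; rewrite /kleene_star summxE.
by rewrite (mt_le_sum (fun k => (A ^+ k) i j)) ?mem_index_iota.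
Qed.

(** After shortening, the nodes are distinct, so the walk has at most [n - 1] edges and its weight
    is counted in a power that occurs in the star. *)
Lemma walk_weight_le_kleene_star A i s : cycles_le1 A ->
  walk_weight A i s <= kleene_star A i (last i s).
Proof.
move=> A1; have [s' [<- us ws]] := walk_shorten i s A1.
apply: le_trans ws _; apply: le_trans (walk_weight_le_expmx _ _ _) _.
apply: expmx_le_kleene_star; rewrite -[size s']/(size (i :: s')).-1.
by have /= := max_card (mem (i :: s')); rewrite (card_uniqP us) card_ord.
Qed.

Lemma kleene_star_walk A i j : exists s,
  kleene_star A i j <= walk_weight A i s /\
    (kleene_star A i j != 0 -> last i s = j).
Proof.
have n0 : (0 < #|'I_n|)%N by apply/card_gt0P; exists i.
have [k] := mt_sum_attained (fun k : 'I_n => (A ^+ k) i j) n0.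
rewrite /kleene_star summxE big_mkord => ->; exact: expmx_walk.
Qed.

Lemma mul_kleene_star_le A i j : cycles_le1 A ->
  (A *m kleene_star A) i j <= kleene_star A i j.
Proof.
move=> A1; rewrite mxE; apply: mt_sum_le => k _.
have [s [ws ls]] := kleene_star_walk A k j.
have [->|/ls {}ls] := eqVneq (kleene_star A k j) 0.
  by rewrite mulr0 mt_ge0.
(* Prepend the edge from [i] to [k] to a walk that realizes the star entry. *)
apply: le_trans (mt_mul_le (lexx _) ws) _.
by have := walk_weight_le_kleene_star i (k :: s) A1; rewrite /= ls.
Qed.

Lemma kleene_star_diag A i : (1 : maxtimes R) <= kleene_star A i i.
Proof.
have := @expmx_le_kleene_star A 0 i i; rewrite expr0 mxE eqxx; apply.
exact: leq_ltn_trans (ltn_ord i).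
Qed.

(** Chaining [A i j * x j 0 <= x i 0] along a walk bounds its weight times the entry at its end by
    the entry at its start; on a cycle these nonzero entries cancel. *)
Lemma cycles_le1_of_subeigenvector A (x : 'cV[maxtimes R]_n) :
  regular x -> (forall i, (A *m x) i 0 <= x i 0) -> cycles_le1 A.
Proof.
move=> x0 Ax i s ls.
suff h : walk_weight A i s * x (last i s) 0 <= x i 0.
  by rewrite -(mt_le_mul2r _ _ (x0 i 0)) mul1r; rewrite ls in h.
elim: s i {ls} => [|j s IH] i /=; first by rewrite mul1r.
apply: le_trans (Ax i); apply: le_trans (mulmx_entry_le _ _ _ _ j).
by rewrite -mulrA; apply: mt_mul_le.
Qed.

(** Iterating the hypothesis bounds every [A ^+ k *m x] by [x]; the identity term of the star gives
    the converse bound. *)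
Lemma mul_kleene_star_subeigenvector A (x : 'cV[maxtimes R]_n) :
  (forall i, (A *m x) i 0 <= x i 0) -> kleene_star A *m x = x.
Proof.
move=> Ax; apply/matrixP => i j; rewrite ord1; apply/le_anti/andP; split.
- rewrite /kleene_star mulmx_suml summxE; apply: mt_sum_le => k _.
  elim: k i => [|k IH] i; first by rewrite expr0 mul1mx.
  apply: le_trans (Ax i); rewrite exprS -mulmxA [leLHS]mxE.
  apply: mt_sum_le => l _; apply: le_trans (mulmx_entry_le _ _ _ _ l).
  exact: mt_mul_le.
- apply: le_trans (mulmx_entry_le _ _ _ _ i).
  by rewrite -[leLHS]mul1r mt_mul_le ?kleene_star_diag.
Qed.

(** Strong induction on length: a closed walk with more than [n] edges revisits a node, hence splits
    into two shorter closed walks whose bounds multiply. *)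
Lemma cycle_weight_le A (t : maxtimes R) :
  (forall i s, (0 < size s <= n)%N -> last i s = i ->
     walk_weight A i s <= t ^+ size s) ->
  forall i s, last i s = i -> walk_weight A i s <= t ^+ size s.
Proof.
move=> h i s; have [k] := ubnP (size s); elim: k i s => // k IH i s sk ls.
have [->|s0] := eqVneq s [::]; first by [].
have [sn|ns] := leqP (size s) n; first by apply: h; rewrite // lt0n size_eq0 s0.
have /not_uniq_split [y [s1 [s2 [s3 es]]]] : ~~ uniq s.
  apply/negP => us; move: ns; rewrite ltnNge -(card_uniqP us).
  by apply/negP; rewrite negbK (leq_trans (max_card _)) // card_ord.
(* The block [rcons s2 y] is a closed walk at [y]; deleting it leaves the closed walk
   [rcons s1 y ++ s3] at [i]. *)
have es' : s = rcons s1 y ++ (rcons s2 y ++ s3).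
  by rewrite es !cat_rcons.
rewrite es' !walk_weight_cat !last_rcons mulrCA !size_cat addnCA exprD.
move: sk; rewrite es' !size_cat !size_rcons ltnS => sk.
apply: mt_mul_le.
- rewrite -(size_rcons s2 y); apply: IH; last by rewrite last_rcons.
  by rewrite size_rcons; lia.
- have := IH i (rcons s1 y ++ s3); rewrite walk_weight_cat last_rcons.
  rewrite size_cat !size_rcons; apply; first by lia.
  by rewrite last_cat last_rcons -[RHS]ls es' !last_cat !last_rcons.
Qed.

(** Only finitely many closed walks have 1 to [n] edges, so the largest geometric mean among them is
    attained; [cycle_weight_le] extends the bound to all lengths. *)
Lemma max_cycle_mean A : (0 < n)%N -> exists t i s,
  [/\ s != [::], last i s = i, walk_weight A i s = t ^+ size s &
    forall j r, last j r = j -> walk_weight A j r <= t ^+ size r].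
Proof.
move=> n0; pose i0 := Ordinal n0.
(* A closed walk is encoded by the tuple of its successive nodes, the last one
   being also its starting point. *)
pose T (k : 'I_n) := k.+1.-tuple 'I_n.
(* The tuple is nonempty, so the default [i0] of [last] is never returned. *)
pose F (c : {k : 'I_n & T k}) : maxtimes R :=
  mt_root (tag c).+1 (walk_weight A (last i0 (tagged c)) (tagged c)).
pose c0 : {k : 'I_n & T k} := Tagged T [tuple of nseq (val i0).+1 i0].
have [[k c] _ cmax] := arg_maxP F (isT : predT c0).
exists (F (Tagged T c)), (last i0 c), c; split.
- by rewrite -size_eq0 size_tuple.
- by case: c {cmax} => -[].
- by rewrite size_tuple mt_rootK.
apply: cycle_weight_le => j r /andP[r0 rn] lr.
have kr : ((size r).-1 < n)%N by rewrite prednK.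
have sr : size r == (Ordinal kr).+1 by rewrite /= prednK.
have <- : F (Tagged T (Tuple sr)) ^+ size r = walk_weight A j r.
  rewrite [X in _ ^+ X](eqP sr) mt_rootK /=.
  by have -> : last i0 r = j by case: r r0 lr {rn kr sr}.
exact/mt_exp_le/cmax.
Qed.

Lemma regular_mulmx_neq0 A (x : 'cV[maxtimes R]_n) :
  regular A -> x != 0 -> regular (A *m x).
Proof.
move=> A0 x0 i j; rewrite ord1.
have [k xk] : exists k, x k 0 != 0.
  apply/existsP; apply: contraR x0; rewrite negb_exists => /forallP x0.
  by apply/eqP/matrixP => k l; rewrite ord1 mxE; apply/eqP/negPn.
apply: contraTneq (mulmx_entry_le A x i 0 k) => ->.
rewrite -ltNge lt_neqAle mt_ge0 andbT eq_sym mt_mul_neq0 xk andbT; exact: A0.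
Qed.

End Walks.

(** * Eigenvectors, the spectral radius, and the objective function *)

Section Spectral.
Context {R : realType} {n : nat}.
Implicit Types (A B : 'M[maxtimes R]_n) (x v : 'cV[maxtimes R]_n).

Lemma mulmx_mono A x v : (forall j, x j 0 <= v j 0) ->
  forall i, (A *m x) i 0 <= (A *m v) i 0.
Proof.
move=> xv i; rewrite [leLHS]mxE; apply: mt_sum_le => k _.
by apply: le_trans (mulmx_entry_le _ _ _ _ k); apply: mt_mul_le.
Qed.

(** The column is taken at a node [i] on a critical cycle, which has weight 1 in [C]. This cycle is
    what turns [C *m v <= v] into an equality. *)
Lemma eigenvector_exists A : (0 < n)%N -> regular A ->
  exists t, exists2 v : 'cV_n, v != 0 & A *m v = t *: v.
Proof.
move=> n0 A0; have [t [i [s [s0 ls ws wle]]]] := max_cycle_mean A n0.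
(* A loop at one node is a cycle of nonzero weight. *)
have t0 : t != 0.
  have := wle (Ordinal n0) [:: Ordinal n0] erefl; rewrite /= mulr1 expr1.
  apply: contraTneq => ->.
  by rewrite -ltNge lt_neqAle mt_ge0 andbT eq_sym; apply: A0.
pose C := mt_inv t *: A.
have tC : A = t *: C by rewrite scalerA mulrC mt_mulVx // scale1r.
have tK k : mt_inv t ^+ k * t ^+ k = 1.
  by rewrite -exprMn mt_mulVx // expr1n.
have C1 : cycles_le1 C.
  move=> j r lr; rewrite walk_weight_scale -(tK (size r)).
  by apply: mt_mul_le => //; apply: wle.
have wC : walk_weight C i s = 1 by rewrite walk_weight_scale ws tK.
pose v := col i (kleene_star C); exists t, v.
  apply/eqP => v0; have := kleene_star_diag C i.
  have -> : kleene_star C i i = v i 0 by rewrite mxE.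
  by rewrite v0 mxE mt_leE /= ler10.
suff Cv : C *m v = v by rewrite [in LHS]tC -scalemxAl Cv.
rewrite /v colE mulmxA -!colE; apply/matrixP => j k.
rewrite [LHS]mxE [RHS]mxE {k}; apply/le_anti; rewrite mul_kleene_star_le //=.
have h r : r != [::] -> last j r = i ->
    walk_weight C j r <= (C *m kleene_star C) j i.
  case: r => // l r _ /= lr; apply: le_trans (mulmx_entry_le _ _ _ _ l).
  by apply: mt_mul_le => //; rewrite -lr walk_weight_le_kleene_star.
apply: kleene_star_le => r lr.
(* The empty walk has no first edge to split off; the critical cycle [s], also of weight 1, replaces
   it. *)
have [r0|/h] := eqVneq r [::]; last exact.
move: lr; rewrite r0 /= => ji; move: h; rewrite ji => h.
by rewrite -wC; apply: h.
Qed.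

(** This serves twice: for the maximality of an eigenvalue that has a regular eigenvector, and for
    the lower bound on the objective. *)
Lemma eigenvalue_le_supereigenvalue A x v (t l : maxtimes R) :
  v != 0 -> A *m v = l *: v -> regular x ->
  (forall i, (A *m x) i 0 <= t * x i 0) -> l <= t.
Proof.
move=> v0 Av x0 Ax.
have [i0 vi0] : exists k, v k 0 != 0.
  apply/existsP; apply: contraR v0; rewrite negb_exists => /forallP v0.
  by apply/eqP/matrixP => k j; rewrite ord1 mxE; apply/eqP/negPn.
(* The smallest [c] with [v <= c *: x] is the largest ratio of entries; at the index [i] attaining
   it, the two sides agree. *)
have [i _ imax] :=
  arg_maxP (fun j => v j 0 * mt_inv (x j 0)) (isT : predT i0).
set c := v i 0 * mt_inv (x i 0) in imax.
have xK j : v j 0 = v j 0 * mt_inv (x j 0) * x j 0.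
  by rewrite -mulrA mt_mulVx // mulr1.
have vc j : v j 0 <= (c *: x) j 0.
  by rewrite mxE xK; apply: mt_mul_le => //; apply: imax.
(* Otherwise [c = 0], which forces [v = 0]. *)
have vi : v i 0 != 0.
  apply: contraNneq vi0 => vi; have := vc i0.
  rewrite mxE /c vi !mul0r => h; apply/eqP/le_anti.
  by rewrite h mt_ge0.
rewrite -(mt_le_mul2r _ _ vi).
have -> : l * v i 0 = (A *m v) i 0 by rewrite Av mxE.
apply: le_trans (mulmx_mono A vc i) _.
by rewrite -scalemxAr mxE [in leRHS]xK mulrCA; apply: mt_mul_le.
Qed.

(** A regular matrix maps nonzero vectors to regular ones, so [t *: x] has no zero entry. *)
Lemma regular_eigenvector A x t : (0 < n)%N ->
  regular A -> x != 0 -> A *m x = t *: x -> t != 0 /\ regular x.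
Proof.
move=> n0 A0 x0 Ax.
have h i : (t != 0) && (x i 0 != 0).
  by rewrite -mt_mul_neq0; have := regular_mulmx_neq0 A0 x0 i 0; rewrite Ax mxE.
split; first by have /andP[] := h (Ordinal n0).
by move=> i j; rewrite ord1; have /andP[] := h i.
Qed.

(** An eigenvalue with a regular eigenvector dominates all others, so the default of [xget] is never
    reached. *)
Lemma spectral_radius_max_eigenvalue A : (0 < n)%N -> regular A ->
  max_eigenvalue A (spectral_radius A).
Proof.
move=> n0 A0; rewrite /spectral_radius; apply: xgetPex.
have [t [v v0 Av]] := eigenvector_exists n0 A0.
exists t; split=> [|l [x x0 Ax]]; first by exists v.
have [_ rv] := regular_eigenvector n0 A0 v0 Av.
apply: (eigenvalue_le_supereigenvalue x0 Ax rv) => i.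
by rewrite Av mxE.
Qed.

Lemma conj_tr_outer x : conj_tr (x *m conj_tr x) = x *m conj_tr x.
Proof.
apply/matrixP => i j; rewrite !mxE !big_ord1 !mxE.
by rewrite mt_invM mt_invK mulrC.
Qed.

(** The outer product is its own conjugate transpose, and cyclicity of the trace turns each trace in
    [rho] into a 1 by 1 product. *)
Lemma sum_rho_outer (I : finType) (A : I -> 'M[maxtimes R]_n) x :
  \sum_i rho (A i) (x *m conj_tr x) =
  (conj_tr x *m ((\sum_i (A i + conj_tr (A i))) *m x)) 0 0.
Proof.
rewrite mulmx_suml mulmx_sumr summxE; apply: eq_bigr => i _.
rewrite /rho conj_tr_outer -mulmxA mxtrace_mulC -mulmxA.
rewrite (mulmxA (conj_tr (A i))) (mxtrace_mulC _ (conj_tr x)).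
by rewrite !trace_mx11 mulmxDl mulmxDr [RHS]mxE.
Qed.

Lemma conj_tr_mul_le x v (t : maxtimes R) : regular x ->
  (conj_tr x *m v) 0 0 <= t <-> forall i, v i 0 <= t * x i 0.
Proof.
move=> x0; have e i : (conj_tr x 0 i * v i 0 <= t) = (v i 0 <= t * x i 0).
  by rewrite -(mt_le_mul2r _ _ (x0 i 0)) mxE mulrAC mt_mulVx // mul1r.
split=> [h i|h].
- by rewrite -e; apply: le_trans h; apply: mulmx_entry_le.
- by rewrite mxE; apply: mt_sum_le => i _; rewrite e.
Qed.

(** Forwards, [u = x] works because the star fixes [x]. Backwards, the diagonal of the star keeps
    the product regular, and [A] times the star is below the star. *)
Lemma regular_subeigenvectorP A x : (0 < n)%N -> cycles_le1 A ->
  (regular x /\ forall i, (A *m x) i 0 <= x i 0) <->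
  exists2 u, regular u & x = kleene_star A *m u.
Proof.
move=> n0 A1; split=> [[x0 Ax]|[u u0 ->]].
  by exists x; rewrite ?mul_kleene_star_subeigenvector.
split=> [i j|i].
- rewrite ord1; have := u0 i 0; rewrite !mt_neq0 => /lt_le_trans; apply.
  rewrite -mt_leE; apply: le_trans (mulmx_entry_le _ _ _ _ i).
  by rewrite -[leLHS]mul1r mt_mul_le ?kleene_star_diag.
- rewrite mulmxA [leLHS]mxE; apply: mt_sum_le => k _.
  apply: le_trans (mulmx_entry_le _ _ _ _ k).
  by apply: mt_mul_le => //; apply: mul_kleene_star_le.
Qed.

End Spectral.

Unset Implicit Arguments.

Theorem theorem4 (R : realType) (n m : nat) (n_gt0 : (0 < n)%N)
    (A : 'I_m -> 'M[maxtimes R]_n) :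
  let B : 'M[maxtimes R]_n := \sum_(i < m) (A i + conj_tr (A i)) in
  regular B ->
  let mu : maxtimes R := spectral_radius B in
  let Bmu : 'M[maxtimes R]_n := mt_inv mu *: B in
  let objective (x : 'cV[maxtimes R]_n) : maxtimes R :=
    \sum_(i < m) rho (A i) (x *m conj_tr x) in
  let feasible : set 'cV[maxtimes R]_n := [set x | regular x] in
  minimum_value feasible objective mu /\
  forall x : 'cV[maxtimes R]_n,
    minimizer feasible objective x <->
    exists2 u : 'cV[maxtimes R]_n, regular u & x = kleene_star Bmu *m u.
Proof.
move=> B B0 mu Bmu objective feasible.
have [[v v0 Bv] _] := spectral_radius_max_eigenvalue n_gt0 B0.
rewrite -/mu in Bv; have [mu0 rv] := regular_eigenvector n_gt0 B0 v0 Bv.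
have objP x t : regular x ->
    objective x <= t <-> forall i, (B *m x) i 0 <= t * x i 0.
  by move=> rx; rewrite /objective sum_rho_outer; apply: conj_tr_mul_le.
have mu_le x : regular x -> mu <= objective x.
  move=> rx; apply: (eigenvalue_le_supereigenvalue v0 Bv rx).
  exact/(objP _ _ rx).
have obj_v : objective v = mu.
  apply/le_anti; rewrite mu_le // andbT.
  by apply/(objP _ _ rv) => i; rewrite Bv mxE.
split; first by split=> [|x /mu_le]; [exists v|].
have BmuP x : (forall i, (B *m x) i 0 <= mu * x i 0) <->
    forall i, (Bmu *m x) i 0 <= x i 0.
  have e i : (B *m x) i 0 = mu * (Bmu *m x) i 0.
    by rewrite -scalemxAl [in RHS]mxE mulrA (mulrC mu) mt_mulVx // mul1r.
  have le i : ((B *m x) i 0 <= mu * x i 0) = ((Bmu *m x) i 0 <= x i 0).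
    by rewrite e !(mulrC mu) mt_le_mul2r.
  by split=> h i; [rewrite -le|rewrite le].
(* The regular eigenvector [v] of [B] is a subeigenvector of [Bmu]. *)
have Bmu1 : cycles_le1 Bmu.
  by apply: (cycles_le1_of_subeigenvector rv); apply/BmuP => i; rewrite Bv mxE.
move=> x; apply: iff_trans (regular_subeigenvectorP x n_gt0 Bmu1).
split=> [[rx xmin]|[rx /BmuP/(objP _ _ rx) xmu]].
- split=> //; apply/BmuP/(objP _ _ rx).
  by rewrite -obj_v; apply: xmin.
- by split=> // y /mu_le; apply: le_trans.
Qed.
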